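(* Let $L\subseteq\mathbb R^2$ be a line, let $A\in\mathbb R^2$ be a point not on $L$, let $B$ be the reflection of $A$ with respect to $L$, and let $P$ be the intersection point of $L$ with the line $L_{AB}$. Let $n$ be a real number with $0<|n|<1$. Let $O_k\in L_{AB}$, $k\in\mathbb N$, be any sequence of points lying in the open half-plane bounded by $L$ that does not contain $A$, with $O_k$ tending to infinity. Set $r_k:=\|P-O_k\|$ and $$B_k:=O_k+\frac{r_k^2}{\|A-O_k\|^2}(A-O_k).$$ Then, as $k\to\infty$, $B_k\to B$ and $\|A-O_k\|/r_k\to1$, so that for each $\sigma_1,\sigma_2\in\{-1,1\}$ the equation $$\|A-M\|+\sigma_1\frac{\|A-O_k\|}{r_k}\|B_k-M\|=\sigma_2\frac{\|A-B_k\|\,\|A-O_k\|}{r_k|n|}$$ tends to the equation $$\|A-M\|+\sigma_1\|B-M\|=\sigma_2\frac{\|A-B\|}{|n|}.$$ Moreover, among these four limiting equations, the only one that defines a real curve is the one with $(\sigma_1,\sigma_2)=(1,1)$, namely the ellipse $\|A-M\|+\|B-M\|=\|A-B\|/|n|$.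
   Context: $\|\cdot\|$ is the Euclidean norm on $\mathbb R^2$, and $L_{AB}$ is the line spanned by $A$ and $B$. The unknown $M$ ranges over $\mathbb R^2$. An equation ''tends to'' another means that, for every $M$, both the left-hand side and the right-hand side converge to the corresponding side of the limiting equation. (The circles $\mathcal C_k$ with centers $O_k$ and radii $r_k$ degenerate to the line $L$.) *)

(* Defs.v *)
From HB Require Import structures.
From mathcomp Require Import all_boot all_order all_algebra.
From mathcomp Require Import all_classical all_reals all_analysis.

Set Implicit Arguments.
Unset Strict Implicit.
Unset Printing Implicit Defensive.

Import Order.TTheory GRing.Theory Num.Theory.
Import numFieldNormedType.Exports.

Local Open Scope classical_set_scope.
Local Open Scope ring_scope.

(* The plane is 'rV[R]_2.  Its canonical norm `|x| is the
   sup norm, so the Euclidean norm is defined separately; both induce the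
   same (canonical) topology. *)

Definition dot (R : realType) (x y : 'rV[R]_2) : R :=
  \sum_(i < 2) x 0 i * y 0 i.

Definition enorm (R : realType) (x : 'rV[R]_2) : R := Num.sqrt (dot x x).

Definition line_through (R : realType) (X Y : 'rV[R]_2) : set 'rV[R]_2 :=
  [set X + t *: (Y - X) | t in [set: R]].

Definition is_line (R : realType) (L : set 'rV[R]_2) : Prop :=
  exists X Y : 'rV[R]_2, X != Y /\ L = line_through X Y.

Definition orthogonal_to (R : realType) (v : 'rV[R]_2) (L : set 'rV[R]_2)
  : Prop := forall X Y, L X -> L Y -> dot v (Y - X) = 0.

(* H is the foot of the perpendicular from A to L. *)
Definition is_reflection (R : realType) (L : set 'rV[R]_2) (A B : 'rV[R]_2)
  : Prop :=
  exists H : 'rV[R]_2,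
    [/\ L H, orthogonal_to (A - H) L & B = H - (A - H)].

Definition is_open_half_plane (R : realType) (L D : set 'rV[R]_2) : Prop :=
  exists Q v : 'rV[R]_2,
    [/\ L Q, v != 0, orthogonal_to v L & D = [set X | 0 < dot v (X - Q)]].

(* The two sides of an equation in the unknown M are functions of M. *)
Definition equation_tends_to (R : realType)
    (lhs_ rhs_ : nat -> 'rV[R]_2 -> R) (lhs rhs : 'rV[R]_2 -> R) : Prop :=
  forall M : 'rV[R]_2,
    lhs_ k M @[k --> \oo] --> lhs M /\ rhs_ k M @[k --> \oo] --> rhs M.

Definition locus (R : realType) (lhs rhs : 'rV[R]_2 -> R) : set 'rV[R]_2 :=
  [set M | lhs M = rhs M].

(* Some neighbourhood of x in S is homeomorphic to an open interval. *)
Definition locally_arc (R : realType) (S : set 'rV[R]_2) (x : 'rV[R]_2)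
  : Prop :=
  exists (U : set 'rV[R]_2) (f : R -> 'rV[R]_2) (g : 'rV[R]_2 -> R),
    [/\ open U, U x,
        set_bij `]-1, 1[ (U `&` S) f,
        {within `]-1, 1[, continuous f} &
        {within U `&` S, continuous g} /\
        {in `]-1, 1[, cancel f g}].

(* Finitely many singular or isolated points are allowed, as for real
   algebraic curves, but S may not consist of such points only: the empty
   set, finite sets and sets with interior are not real curves. *)
Definition is_real_curve (R : realType) (S : set 'rV[R]_2) : Prop :=
  exists F : set 'rV[R]_2,
    [/\ finite_set F, (S `\` F) !=set0 &
        forall x, (S `\` F) x -> locally_arc S x].

Definition is_ellipse (R : realType) (F1 F2 : 'rV[R]_2) (c : R)
    (S : set 'rV[R]_2) : Prop :=
  enorm (F1 - F2) < c /\ S = [set M | enorm (F1 - M) + enorm (F2 - M) = c].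

Definition limit_lhs (R : realType) (A B : 'rV[R]_2) (s1 : R)
    (M : 'rV[R]_2) : R :=
  enorm (A - M) + s1 * enorm (B - M).

Definition limit_rhs (R : realType) (A B : 'rV[R]_2) (n s2 : R)
    (M : 'rV[R]_2) : R :=
  s2 * (enorm (A - B) / `|n|).

(* Main.v *)
(** In the orthogonal frame with origin P and axes u = B - P and its rotation by
    a right angle, A = P - u, B = P + u and O_k = P + t_k u with t_k > 0 tending
    to +oo; then ||A - O_k|| / r_k = 1 + 1/t_k and B_k = P + (1 + 1/t_k)^-1 u,
    which gives all the limits.  Three of the limiting equations have no
    solution, by positivity of norms or by the triangle inequality.  With
    c = 1/|n| > 1, the fourth one reads (c^2-1) a^2 + c^2 b^2 = c^2 (c^2-1) in
    the coordinates (a, b) of M; off its two vertices on the axis b = 0 it is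
    the union of two open half-ellipses, each of which is a graph over that
    axis. *)

Require Import Defs.
From HB Require Import structures.
From mathcomp Require Import all_boot all_order all_algebra.
From mathcomp Require Import all_classical all_reals all_analysis.
From mathcomp Require Import ring lra.

Set Implicit Arguments.
Unset Strict Implicit.
Unset Printing Implicit Defensive.

Import Order.TTheory GRing.Theory Num.Theory.
Import numFieldNormedType.Exports.

Local Open Scope classical_set_scope.
Local Open Scope ring_scope.

(** * Euclidean inner product and norm on the plane *)

Section Plane.
Context {R : realType}.
Implicit Types (x y z u v M P : 'rV[R]_2) (a b c t : R).

Lemma dotE x y : dot x y = x 0 0 * y 0 0 + x 0 1 * y 0 1.
Proof.
by rewrite /dot !big_ord_recl big_ord0 addr0; congr (_ + x 0 _ * y 0 _);
  exact: val_inj.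
Qed.

Lemma row2P x y : x 0 0 = y 0 0 -> x 0 1 = y 0 1 -> x = y.
Proof.
move=> h0 h1; apply/rowP => -[[|[|//]] i2].
- by rewrite (_ : Ordinal i2 = 0)//; exact: val_inj.
- by rewrite (_ : Ordinal i2 = 1)//; exact: val_inj.
Qed.

Lemma dot_ge0 x : 0 <= dot x x.
Proof. by rewrite dotE; nra. Qed.

Lemma dot_eq0 x : (dot x x == 0) = (x == 0).
Proof.
apply/eqP/eqP => [|->]; last by rewrite dotE !mxE; ring.
by rewrite dotE => h; apply: row2P; rewrite mxE; nra.
Qed.

Lemma enorm_ge0 x : 0 <= enorm x.
Proof. exact: sqrtr_ge0. Qed.

Lemma sqr_enorm x : enorm x ^+ 2 = dot x x.
Proof. exact/sqr_sqrtr/dot_ge0. Qed.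

Lemma enorm_gt0 x : (0 < enorm x) = (x != 0).
Proof. by rewrite sqrtr_gt0 lt_neqAle dot_ge0 andbT eq_sym dot_eq0. Qed.

Lemma enormZ a x : enorm (a *: x) = `|a| * enorm x.
Proof.
rewrite /enorm (_ : dot _ _ = a ^+ 2 * dot x x).
  by rewrite sqrtrM ?sqr_ge0// sqrtr_sqr.
by rewrite !dotE !mxE; ring.
Qed.

Lemma enormN x : enorm (- x) = enorm x.
Proof. by rewrite -scaleN1r enormZ normrN1 mul1r. Qed.

(** Lagrange's identity: the squares of the two sides differ by the square of the determinant of [x]
    and [y]. *)
Lemma dot_le_enorm x y : dot x y <= enorm x * enorm y.
Proof.
apply: (le_trans (ler_norm _)).
rewrite -ler_sqr ?nnegrE ?mulr_ge0 ?enorm_ge0// real_normK ?num_real//.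
rewrite exprMn !sqr_enorm !dotE -subr_ge0.
rewrite (_ : _ - _ = (x 0 0 * y 0 1 - x 0 1 * y 0 0) ^+ 2) ?sqr_ge0//.
by ring.
Qed.

Lemma enormD x y : enorm (x + y) <= enorm x + enorm y.
Proof.
rewrite -ler_sqr ?nnegrE ?addr_ge0 ?enorm_ge0// sqrrD !sqr_enorm.
have := dot_le_enorm x y; rewrite !dotE !mxE; lra.
Qed.

Lemma enorm_continuous : continuous (@enorm R).
Proof.
move=> x; apply: (@continuous_comp _ _ _ (fun z => dot z z) Num.sqrt);
  last by apply: sqrt_continuous.
rewrite (_ : (fun z => _) =
  (fun z : 'rV[R]_2 => z 0 0 * z 0 0 + z 0 1 * z 0 1)); last first.
  by apply/funext => z; rewrite dotE.
have cc i : (fun z : 'rV[R]_2 => z 0 i) @ x --> x 0 i.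
  exact: coord_continuous.
exact: cvgD (cvgM (cc 0) (cc 0)) (cvgM (cc 1) (cc 1)).
Qed.

Lemma dot_continuous u : continuous (dot u).
Proof.
move=> x; rewrite (_ : dot u =
  (fun z : 'rV[R]_2 => u 0 0 * z 0 0 + u 0 1 * z 0 1)); last first.
  by apply/funext => z; rewrite dotE.
have cc i : (fun z : 'rV[R]_2 => z 0 i) @ x --> x 0 i.
  exact: coord_continuous.
exact: cvgD (cvgM (cvg_cst _) (cc 0)) (cvgM (cvg_cst _) (cc 1)).
Qed.

Lemma dotBr x y z : dot x (y - z) = dot x y - dot x z.
Proof. by rewrite !dotE !mxE; ring. Qed.

(** * Coordinates in an orthogonal frame *)

Definition perp u : 'rV[R]_2 := \row_i (if i == 0 then - u 0 1 else u 0 0).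

Definition frame P u a b : 'rV[R]_2 := P + a *: u + b *: perp u.

(** The axes of [frame] keep the length of [u], hence the division by [dot u u]; for nonzero [u] the
    points [P - u] and [P + u] get abscissas -1 and 1. *)
Definition abscissa P u M : R := dot u (M - P) / dot u u.

Definition ordinate P u M : R := dot (perp u) (M - P) / dot u u.

Lemma frameK P u M : u != 0 ->
  frame P u (abscissa P u M) (ordinate P u M) = M.
Proof.
rewrite -dot_eq0 /frame /abscissa /ordinate !dotE => u0.
by apply: row2P; rewrite !mxE /=; field.
Qed.

Lemma abscissa_frame P u a b : u != 0 -> abscissa P u (frame P u a b) = a.
Proof.
rewrite -dot_eq0 /frame /abscissa !dotE => u0.
by rewrite !mxE /=; field.
Qed.

Lemma ordinate_frame P u a b : u != 0 -> ordinate P u (frame P u a b) = b.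
Proof.
rewrite -dot_eq0 /frame /ordinate !dotE => u0.
by rewrite !mxE /=; field.
Qed.

Lemma abscissa_continuous P u : continuous (abscissa P u).
Proof.
move=> M.
rewrite (_ : abscissa P u = fun N => (dot u N - dot u P) / dot u u).
  exact: cvgM (cvgB (@dot_continuous u M) (cvg_cst _)) (cvg_cst _).
by apply/funext => N; rewrite /abscissa -dotBr.
Qed.

Lemma ordinate_continuous P u : continuous (ordinate P u).
Proof.
move=> M.
rewrite (_ : ordinate P u = fun N => (dot (perp u) N - dot (perp u) P) / dot u u).
  exact: cvgM (cvgB (@dot_continuous (perp u) M) (cvg_cst _)) (cvg_cst _).
by apply/funext => N; rewrite /ordinate -dotBr.
Qed.

(** * The ellipse with foci [P - u] and [P + u] *)

Lemma enorm_frame e P u a b :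
  enorm (P + e *: u - frame P u a b) =
  Num.sqrt ((a - e) ^+ 2 + b ^+ 2) * enorm u.
Proof.
rewrite /enorm -sqrtrM ?addr_ge0 ?sqr_ge0//; congr Num.sqrt.
by rewrite !dotE !mxE /=; ring.
Qed.

Lemma sum_dist_ellipseP a b c : 1 < c ->
  Num.sqrt ((a + 1) ^+ 2 + b ^+ 2) + Num.sqrt ((a - 1) ^+ 2 + b ^+ 2) = 2 * c
  <-> (c ^+ 2 - 1) * a ^+ 2 + c ^+ 2 * b ^+ 2 = c ^+ 2 * (c ^+ 2 - 1).
Proof.
move=> c1; have c0 : c != 0 by lra.
split=> [|h].
  (* p^2 - q^2 = 4a and p + q = 2c force p = c + a/c. *)
  set p := Num.sqrt _; set q := Num.sqrt _ => pq.
  have hp : p ^+ 2 = (a + 1) ^+ 2 + b ^+ 2.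
    by rewrite sqr_sqrtr// addr_ge0// sqr_ge0.
  have hq : q ^+ 2 = (a - 1) ^+ 2 + b ^+ 2.
    by rewrite sqr_sqrtr// addr_ge0// sqr_ge0.
  have qE : q = 2 * c - p by lra.
  have pc : p * c = c ^+ 2 + a by move: hq; rewrite qE; nra.
  have : (p * c) ^+ 2 = ((a + 1) ^+ 2 + b ^+ 2) * c ^+ 2 by rewrite exprMn hp.
  by rewrite pc; nra.
have ac : `|a| <= c.
  rewrite -ler_sqr ?nnegrE//; last by lra.
  rewrite real_normK ?num_real//.
  rewrite -(@ler_pM2l _ (c ^+ 2 - 1)); last by nra.
  by have := sqr_ge0 (c * b); rewrite exprMn; nra.
have /andP[ac1 ac2] : - c <= a <= c by rewrite -ler_norml.
(* For [e] equal to 1 and -1, the radicands are the squares of the focal radii [c + a / c] and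
   [c - a / c]. *)
have side e : e ^+ 2 = 1 -> (a + e) ^+ 2 + b ^+ 2 = (c + e * a / c) ^+ 2.
  move=> e1; apply: (mulfI (_ : c ^+ 2 != 0)); first by rewrite expf_neq0.
  rewrite mulrDr (_ : c ^+ 2 * b ^+ 2 = c ^+ 2 * (c ^+ 2 - 1)
    - (c ^+ 2 - 1) * a ^+ 2); last by lra.
  have -> : c ^+ 2 * (c + e * a / c) ^+ 2 = (c ^+ 2 + e * a) ^+ 2 by field.
  apply/eqP; rewrite -subr_eq0; apply/eqP.
  transitivity ((c ^+ 2 - a ^+ 2) * (e ^+ 2 - 1)); first by ring.
  by rewrite e1 subrr mulr0.
(* As [c > 1], both focal radii are positive, so the square roots are these radii and add up to
   [2 * c]. *)
have quot : -1 <= a / c <= 1.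
  by rewrite ler_pdivlMr ?ler_pdivrMr ?mulN1r ?mul1r ?ac1//; lra.
rewrite (side 1) ?expr1n// (side (-1)) ?sqrrN ?expr1n// !sqrtr_sqr.
rewrite mulN1r mul1r mulNr !ger0_norm; lra.
Qed.

Lemma ellipse_frameP P u a b c : u != 0 -> 1 < c ->
  enorm (P - u - frame P u a b) + enorm (P + u - frame P u a b)
    = 2 * c * enorm u
  <-> (c ^+ 2 - 1) * a ^+ 2 + c ^+ 2 * b ^+ 2 = c ^+ 2 * (c ^+ 2 - 1).
Proof.
move=> u0 c1; rewrite -(sum_dist_ellipseP a b c1).
have := enorm_frame (-1) P u a b; rewrite scaleN1r opprK => ->.
have := enorm_frame 1 P u a b; rewrite scale1r => ->.
rewrite -mulrDl; split=> [|->//].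
by apply: mulIf; rewrite gt_eqF// enorm_gt0.
Qed.

(** The sign [s] selects a side of the focal axis. The half-ellipse there is a graph over that axis,
    and projection to the axis is a continuous inverse of its parametrization. *)
Lemma half_ellipse_arc P u c s M : u != 0 -> 1 < c -> s ^+ 2 = 1 ->
  let S := [set M | enorm (P - u - M) + enorm (P + u - M) = 2 * c * enorm u] in
  S M -> 0 < s * ordinate P u M -> locally_arc S M.
Proof.
move=> u0 c1 s1 S SM yM.
have c0 : c != 0 by lra.
have b0 : 0 < c ^+ 2 - 1 by nra.
(* Semi-minor axis in units of [enorm u]; the semi-major axis is [c]. *)
pose b := Num.sqrt (c ^+ 2 - 1).
have b2 : b ^+ 2 = c ^+ 2 - 1 by rewrite sqr_sqrtr ?ltW.
have bp : 0 < b by rewrite sqrtr_gt0.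
pose f t := frame P u (c * t) (s * (b * Num.sqrt (1 - t ^+ 2))).
pose g M := abscissa P u M / c.
have fK : {in `]-1, 1[, cancel f g}.
  by move=> t _; rewrite /g /f abscissa_frame// mulrC mulKf.
exists [set M | 0 < s * ordinate P u M], f, g; split.
- have cy : continuous (fun M => s * ordinate P u M).
    by move=> N; exact: cvgM (cvg_cst s) (@ordinate_continuous P u N).
  apply: (@open_comp _ _ (fun M => s * ordinate P u M) [set y | 0 < y]).
    by move=> N _; exact: cy.
  exact: open_gt.
- exact: yM.
- split.
  + move=> t; rewrite /= in_itv/= => /andP[t1 t2].
    have t0 : 0 < 1 - t ^+ 2 by nra.
    split => /=.
      rewrite ordinate_frame// mulrA -expr2 s1 mul1r mulr_gt0//.
      by rewrite sqrtr_gt0.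
    apply/ellipse_frameP => //.
    by rewrite !exprMn s1 b2 sqr_sqrtr ?ltW//; ring.
  + by move=> t t' /set_mem ht /set_mem ht' e; rewrite -(fK t ht) e fK.
  + move=> N [/= yN SN].
    have XE : abscissa P u N = c * g N by rewrite /g mulrCA divff ?mulr1.
    (* The ellipse equation divided by [c ^+ 2]; positivity of [s * ordinate P u N] then singles out
       the positive root. *)
    have e : (s * ordinate P u N) ^+ 2 = b ^+ 2 * (1 - g N ^+ 2).
      rewrite exprMn s1 mul1r b2; apply: (mulfI (_ : c ^+ 2 != 0)).
        by rewrite expf_neq0.
      have : S (frame P u (abscissa P u N) (ordinate P u N)) by rewrite frameK.
      by move=> /(ellipse_frameP _ _ _ u0 c1); rewrite XE exprMn; lra.
    have t0 : 0 < 1 - g N ^+ 2.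
      by rewrite -(pmulr_rgt0 _ (_ : 0 < b ^+ 2)) ?exprn_gt0// -e exprn_gt0.
    have yE : b * Num.sqrt (1 - g N ^+ 2) = s * ordinate P u N.
      rewrite -[RHS]gtr0_norm// -sqrtr_sqr e sqrtrM ?sqr_ge0// sqrtr_sqr.
      by rewrite gtr0_norm.
    exists (g N); first by rewrite /= in_itv/=; apply/andP; split; nra.
    by rewrite /f yE mulrA -expr2 s1 mul1r -XE frameK.
(* [Num.sqrt] vanishes on negative reals and is continuous everywhere, so [f] is continuous on all
   of [R]. *)
- apply: continuous_subspaceT => t.
  have sq : Num.sqrt (1 - z ^+ 2) @[z --> t] --> Num.sqrt (1 - t ^+ 2).
    apply: continuous_cvg; first by apply: sqrt_continuous.
    by apply: cvgB; [exact: cvg_cst|exact: exprn_continuous].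
  exact: cvgD (cvgD (cvg_cst _) (cvgZr_tmp (cvgM (cvg_cst c) cvg_id)))
    (cvgZr_tmp (cvgM (cvg_cst s) (cvgM (cvg_cst b) sq))).
- split=> //; apply: continuous_subspaceT.
  by move=> N; exact: cvgM (@abscissa_continuous P u N) (cvg_cst c^-1).
Qed.

(** The exceptional points are the vertices on the focal axis; elsewhere the ordinate is nonzero and
    its sign tells which half-ellipse applies. *)
Lemma ellipse_real_curve P u c : u != 0 -> 1 < c ->
  is_real_curve
    [set M | enorm (P - u - M) + enorm (P + u - M) = 2 * c * enorm u].
Proof.
move=> u0 c1; have b0 : 0 < c ^+ 2 - 1 by nra.
exists [set frame P u c 0; frame P u (- c) 0]; split.
- by rewrite finite_setU; split; exact: finite_set1.
(* An endpoint of the minor axis. *)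
- exists (frame P u 0 (Num.sqrt (c ^+ 2 - 1))); split.
    by apply/ellipse_frameP => //; rewrite sqr_sqrtr ?ltW//; ring.
  by case=> /(congr1 (abscissa P u)); rewrite !abscissa_frame//; lra.
- move=> M [SM FM].
  have y0 : ordinate P u M != 0.
    apply/eqP => y0; apply: FM; rewrite -(frameK P M u0) y0.
    move: SM; rewrite /mkset -{1 2}(frameK P M u0) y0.
    set a := abscissa P u M => /(ellipse_frameP _ _ _ u0 c1) h.
    (* At ordinate 0 the equation factors, forcing the abscissa to be [c] or [- c]. *)
    have /eqP : (c ^+ 2 - 1) * ((a - c) * (a + c)) = 0 by lra.
    rewrite mulf_eq0 gt_eqF//= mulf_eq0 subr_eq0 addr_eq0.
    by case/orP => /eqP ->; [left|right].
  have [yp|yn|y0'] := ltgtP 0 (ordinate P u M).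
  + by apply: (@half_ellipse_arc P u c 1) => //; rewrite ?expr1n ?mul1r.
  + apply: (@half_ellipse_arc P u c (-1)) => //.
      by rewrite sqrrN expr1n.
    by rewrite mulN1r oppr_gt0.
  + by rewrite -y0' eqxx in y0.
Qed.

Lemma not_real_curve0 : ~ is_real_curve (@set0 'rV[R]_2).
Proof. by move=> [F [_ [x [[]]]]]. Qed.

End Plane.

(** * The given configuration in the frame, and empty loci *)

Section Limits.
Context {R : realType}.
Implicit Types (L D : set 'rV[R]_2) (A B P Q u : 'rV[R]_2).

(** [P - H] is a multiple of [A - H], both points being on the line [AB], and is orthogonal to it,
    both being on [L]. As [A - H] is nonzero, [P] is the foot [H], the midpoint of [A] and [B]. *)
Lemma reflection_center L A B P : ~ L A -> is_reflection L A B ->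
  L P -> line_through A B P -> A - P = - (B - P).
Proof.
move=> LA [H [LH orthH ->]] LP [t _ tP].
have AH : dot (A - H) (A - H) != 0.
  by rewrite dot_eq0 subr_eq0; apply: contra_notN LA => /eqP ->.
have PH : P - H = (1 - 2 * t) *: (A - H).
  by rewrite -tP; apply: row2P; rewrite !mxE; ring.
have : (1 - 2 * t) * dot (A - H) (A - H) = 0.
  by rewrite -(orthH _ _ LH LP) PH !dotE !mxE; ring.
move/eqP; rewrite mulf_eq0 (negPf AH) orbF => /eqP t12.
have -> : P = H by apply/eqP; rewrite -subr_eq0 PH t12 scale0r.
by apply: row2P; rewrite !mxE; ring.
Qed.

(** The base point may slide along [L], which is orthogonal to the normal [v]. *)
Lemma open_half_planeP L D P : is_open_half_plane L D -> L P ->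
  exists v, D = [set X | 0 < dot v (X - P)].
Proof.
move=> [Q [v [LQ _ orthv ->]]] LP; exists v; apply/seteqP.
have PQ := orthv _ _ LQ LP.
suff vE X : dot v (X - Q) = dot v (X - P) by split=> X /=; rewrite vE.
by move: PQ; rewrite !dotBr; lra.
Qed.

(** The triangle inequality bounds [enorm (O k)] by [enorm P + t k * enorm u]. *)
Lemma ray_cvgy P u (O : nat -> 'rV[R]_2) (t : nat -> R) : u != 0 ->
  (forall k, 0 < t k /\ O k = P + t k *: u) ->
  enorm (O k) @[k --> \oo] --> +oo -> t k @[k --> \oo] --> +oo.
Proof.
move=> u0 Ot /cvgryPge h; apply/cvgryPge => a.
near=> k; have [t0 Ok] := Ot k.
rewrite -(ler_pM2r (_ : 0 < enorm u)) ?enorm_gt0// -(lerD2l (enorm P)).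
have : enorm P + a * enorm u <= enorm (O k) by near: k; exact: h.
move=> /le_trans; apply; rewrite Ok; apply: (le_trans (enormD _ _)).
by rewrite enormZ gtr0_norm.
Unshelve. all: by end_near. Qed.

Lemma sum_dist_neg_empty A B c : 0 < c ->
  [set M | enorm (A - M) + enorm (B - M) = - c] = set0.
Proof.
move=> c0; apply/seteqP; split=> // M /=.
by have := enorm_ge0 (A - M); have := enorm_ge0 (B - M); lra.
Qed.

(** By the triangle inequality, distances from [M] to [A] and to [B] differ by at most
    [enorm (A - B)]. *)
Lemma diff_dist_empty A B c : enorm (A - B) < `|c| ->
  [set M | enorm (A - M) - enorm (B - M) = c] = set0.
Proof.
move=> ABc; apply/seteqP; split=> // M /= h; move: ABc; rewrite -h.
apply/negP; rewrite -leNgt ler_norml.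
have := enormD (A - B) (B - M); have := enormD (B - A) (A - M).
by rewrite !addrA !subrK -(enormN (B - A)) opprB; lra.
Qed.

End Limits.

(** * Degeneration of the circles to the line, and the limiting equations *)

Theorem mainTheorem4 (R : realType) (L : set 'rV[R]_2) (A B P : 'rV[R]_2)
    (n : R) (D : set 'rV[R]_2) (Ok : nat -> 'rV[R]_2)
    (r : nat -> R) (Bk : nat -> 'rV[R]_2)
    (hL : is_line L) (hA : ~ L A) (hB : is_reflection L A B)
    (hP : L P /\ line_through A B P)
    (hn : 0 < `|n| < 1)
    (hD : is_open_half_plane L D) (hDA : ~ D A)
    (hOline : forall k, line_through A B (Ok k))
    (hOD : forall k, D (Ok k))
    (hOinfty : enorm (Ok k) @[k --> \oo] --> +oo)
    (hr : forall k, r k = enorm (P - Ok k))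
    (hBk : forall k, Bk k =
       Ok k + (r k ^+ 2 / enorm (A - Ok k) ^+ 2) *: (A - Ok k)) :
  [/\ Bk k @[k --> \oo] --> B,
      enorm (A - Ok k) / r k @[k --> \oo] --> (1 : R),
      (forall s1 s2 : R, s1 = -1 \/ s1 = 1 -> s2 = -1 \/ s2 = 1 ->
        equation_tends_to
          (fun k M =>
             enorm (A - M) + s1 * (enorm (A - Ok k) / r k) * enorm (Bk k - M))
          (fun k M =>
             s2 * (enorm (A - Bk k) * enorm (A - Ok k) / (r k * `|n|)))
          (limit_lhs A B s1) (limit_rhs A B n s2)),
      (forall s1 s2 : R, s1 = -1 \/ s1 = 1 -> s2 = -1 \/ s2 = 1 ->
        is_real_curve (locus (limit_lhs A B s1) (limit_rhs A B n s2)) <->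
        s1 = 1 /\ s2 = 1) &
      is_ellipse A B (enorm (A - B) / `|n|)
        (locus (limit_lhs A B 1) (limit_rhs A B n 1))].
Proof.
have Lne : A - P = - (B - P) by case: hP; exact: reflection_center hA hB.
set u := B - P in Lne.
have AE : A = P - u by rewrite -Lne addrC subrK.
have BE : B = P + u by rewrite /u addrC subrK.
have u0 : u != 0.
  by apply: contra_notN hA => /eqP h; rewrite AE h subr0; case: hP.
have nu0 : 0 < enorm u by rewrite enorm_gt0.
have [v DE] := open_half_planeP hD hP.1.
have hO k : exists t, 0 < t /\ Ok k = P + t *: u.
  (* A point [A + t *: (B - A)] equals [P - u + (2 * t) *: u]. *)
  have [t _ tO] := hOline k; exists (2 * t - 1).
  have OE : Ok k = P + (2 * t - 1) *: u.
    by rewrite -tO AE BE; apply: row2P; rewrite !mxE; ring.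
  (* [A = P - u] lies outside [D], so [dot v u] is nonnegative; [Ok k] lies in [D], so its
     coefficient times [dot v u] is positive. *)
  split=> //; move: (hOD k) hDA; rewrite DE /= OE Lne => Ok0 /negP.
  rewrite -leNgt; move: Ok0.
  have -> : P + (2 * t - 1) *: u - P = (2 * t - 1) *: u by rewrite addrC addKr.
  rewrite !dotE !mxE => Ok0 A0; nra.
have [t ht] := choice hO.
have ty := ray_cvgy u0 ht hOinfty.
have tV : (t k)^-1 @[k --> \oo] --> (0 : R).
  by apply/gtr0_cvgV0 => //; apply: nearW => k; case: (ht k).
have rE k : r k = t k * enorm u.
  have [t0 OE] := ht k.
  rewrite hr OE -enormN opprB [_ + _ *: _]addrC addrK enormZ gtr0_norm//.
have AO k : enorm (A - Ok k) = (1 + t k) * enorm u.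
  have [t0 OE] := ht k.
  rewrite -enormN (_ : - _ = (1 + t k) *: u).
    by rewrite enormZ gtr0_norm// addr_gt0.
  by rewrite OE AE; apply: row2P; rewrite !mxE; ring.
have ratioE k : enorm (A - Ok k) / r k = 1 + (t k)^-1.
  have [t0 OE] := ht k.
  by rewrite AO rE; field; rewrite !gt_eqF.
have BkE k : Bk k = P + (1 + (t k)^-1)^-1 *: u.
  have [t0 OE] := ht k.
  rewrite hBk AO rE OE AE; apply: row2P; rewrite !mxE; field;
    by rewrite !gt_eqF//= addr_gt0.
have ratio1 : 1 + (t k)^-1 @[k --> \oo] --> (1 : R).
  by rewrite -[X in _ --> X]addr0; exact: cvgD (cvg_cst _) tV.
have cvgBk : Bk k @[k --> \oo] --> B.
  rewrite (funext BkE) BE -[X in _ + X]scale1r -[X in X *: _]invr1.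
  by apply: cvgD; [exact: cvg_cst|apply: cvgZr_tmp; exact: cvgV].
have cvgAO : enorm (A - Ok k) / r k @[k --> \oo] --> (1 : R).
  by rewrite (funext ratioE).
have cvg_enorm (Y : 'rV[R]_2) (F : nat -> 'rV[R]_2) :
    F k @[k --> \oo] --> Y -> enorm (F k) @[k --> \oo] --> enorm Y.
  by move=> FY; apply: continuous_cvg => //; exact: enorm_continuous.
have [n0 n1] := andP hn.
have c1 : 1 < `|n|^-1 by rewrite invf_gt1.
have ABE : enorm (A - B) = 2 * enorm u.
  rewrite -enormN (_ : - _ = 2 *: u) ?enormZ ?gtr0_norm//.
  by rewrite AE BE; apply: row2P; rewrite !mxE; ring.
have AB0 : 0 < enorm (A - B) by rewrite ABE mulr_gt0.
have ABn : enorm (A - B) < enorm (A - B) / `|n| by rewrite ltr_pMr.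
split=> //.
- move=> s1 s2 _ _ M; split.
    have -> : limit_lhs A B s1 M =
        enorm (A - M) + s1 * 1 * enorm (B - M) by rewrite /limit_lhs mulr1.
    apply: cvgD; first exact: cvg_cst.
    apply: cvgM; first exact: cvgM (cvg_cst _) cvgAO.
    exact/cvg_enorm/(cvgB cvgBk (cvg_cst M)).
  rewrite /limit_rhs; apply: cvgM; first exact: cvg_cst.
  (* Regrouped so that the ratio tending to 1 appears as a factor. *)
  rewrite (_ : (fun k => _) =
    (fun k => enorm (A - Bk k) * (enorm (A - Ok k) / r k) / `|n|)).
    rewrite -[enorm (A - B)]mulr1.
    apply: cvgM; last exact: cvg_cst.
    exact: cvgM (cvg_enorm _ _ (cvgB (cvg_cst A) cvgBk)) cvgAO.
  by apply/funext => k; rewrite invfM !mulrA.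
- have locusE s1 s2 : locus (limit_lhs A B s1) (limit_rhs A B n s2) =
    [set M | enorm (A - M) + s1 * enorm (B - M) = s2 * (enorm (A - B) / `|n|)].
    by [].
  have c0 : 0 < enorm (A - B) / `|n| by rewrite divr_gt0.
  (* What remains: emptiness of the locus for the sign pairs (-1, -1), (-1, 1), (1, -1), then the
     ellipse for (1, 1). *)
  move=> s1 s2 [] -> [] ->; rewrite locusE; split=> [|[]]; do ?lra; try by move=> _.
  + under eq_set do rewrite mulN1r; rewrite diff_dist_empty.
      by move/not_real_curve0.
    by rewrite mulN1r normrN gtr0_norm.
  + under eq_set do rewrite mulN1r; rewrite diff_dist_empty.
      by move/not_real_curve0.
    by rewrite mul1r gtr0_norm.
  + under eq_set do rewrite mul1r mulN1r; rewrite sum_dist_neg_empty//.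
    by move/not_real_curve0.
  (* Here [c] is the inverse of [|n|], and [enorm (A - B)] is [2 * enorm u]. *)
  + move=> _ _; have := ellipse_real_curve P u0 c1.
    rewrite -AE -BE; congr is_real_curve; apply/seteqP.
    have -> : 1 * (enorm (A - B) / `|n|) = 2 * `|n|^-1 * enorm u.
      by rewrite ABE mul1r mulrAC.
    by split=> M /=; rewrite mul1r.
- split; first by [].
  by rewrite /locus /limit_lhs /limit_rhs; under eq_set do rewrite !mul1r.
Qed.
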